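(* Let $K$ be a loop with identity $\epsilon$, $G$ a group with identity $e$, and let $K\times^{\Gamma}G$ be the right nuclear Albert extension of $G$ by $K$ determined by a map $\Gamma:K\times K\to\mathrm{Sym}(G)$ with $\Gamma_{\epsilon,\sigma}(e)=e$ and $\Gamma_{\sigma,\epsilon}=\mathrm{Id}$ for all $\sigma\in K$. Put $\Theta_\tau=\Gamma_{\epsilon,\tau}$ and $f(\sigma,\tau)=\Gamma_{\sigma,\tau}(e)$ for $\sigma,\tau\in K$. Then $K\times^{\Gamma}G$ is (i) middle nuclear if and only if all $\Theta_\tau$, $\tau\in K$, are automorphisms of $G$ and $\Gamma$ has the form $\Gamma_{\sigma,\tau}(s)=f(\sigma,\tau)\,\Theta_\tau(s)$ for $\sigma,\tau\in K$, $s\in G$; (ii) left nuclear if and only if all $\Theta_\tau$, $\tau\in K$, are automorphisms of $G$ and $\Gamma$ has the form $\Gamma_{\sigma,\tau}(g)=\Theta_{\sigma\tau}(\Theta_\sigma^{-1}(g))\,f(\sigma,\tau)$ for $\sigma,\tau\in K$, $g\in G$; (iii) nuclear if and only if $\Gamma_{\sigma,\tau}(s)=f(\sigma,\tau)\,\Theta_\tau(s)$ and $\Theta_{\sigma\tau}\Theta_\sigma^{-1}\Theta_\tau^{-1}=\iota_{f(\sigma,\tau)}$ for $\sigma,\tau\in K$, $s\in G$, where $\iota_s(t)=sts^{-1}$ for $s,t\in G$.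
   Context: $\mathrm{Sym}(G)$ is the group of all permutations of the set $G$. For a map $\Gamma:K\times K\to\mathrm{Sym}(G)$ with $\Gamma_{\epsilon,\sigma}(e)=e$ and $\Gamma_{\sigma,\epsilon}=\mathrm{Id}$ for all $\sigma\in K$, the right nuclear Albert extension $K\times^{\Gamma}G$ is the loop on $K\times G$ with multiplication $(\alpha,a)(\beta,b)=(\alpha\beta,\Gamma_{\alpha,\beta}(a)b)$, $\alpha,\beta\in K$, $a,b\in G$. Products of permutations are compositions of functions, applied right to left. The extension is left, middle or right nuclear if its kernel $\{\epsilon\}\times G$ is contained in the left nucleus $\{u: ux\cdot y=u\cdot xy\ \forall x,y\}$, the middle nucleus $\{u: xu\cdot y=x\cdot uy\ \forall x,y\}$, or the right nucleus $\{u: xy\cdot u=x\cdot yu\ \forall x,y\}$ of the loop, respectively; it is nuclear if the kernel is contained in the nucleus, that is, in the intersection of these three nuclei.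
   Formalization: In (iii) the condition that all Θ_τ are automorphisms of G is added to the right-hand side; without it the ''if'' direction fails, e.g. K=Z/2={ε,t}, G=Z/4, Γ_{σ,ε}=Id, Γ_{σ,t}= the transposition (1 2). *)

(* Defs.v *)
(* Groups and loops are built on MathComp's [groupType] and [umagmaType]; neither
   is assumed finite. *)
From HB Require Import structures.
From mathcomp Require Import all_boot.

Set Implicit Arguments.
Unset Strict Implicit.
Unset Printing Implicit Defensive.

Local Open Scope group_scope.

HB.mixin Record UMagma_isLoop L of UMagma L := {
  loop_ldiv : forall a b : L, exists! x : L, a * x = b;
  loop_rdiv : forall a b : L, exists! y : L, y * a = b
}.

#[short(type="loopType")]
HB.structure Definition Loop := {L of UMagma_isLoop L & UMagma L}.

Section Nuclei.
Variable L : loopType.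

Definition left_nucleus (u : L) : Prop :=
  forall x y : L, (u * x) * y = u * (x * y).

Definition middle_nucleus (u : L) : Prop :=
  forall x y : L, (x * u) * y = x * (u * y).

Definition right_nucleus (u : L) : Prop :=
  forall x y : L, (x * y) * u = x * (y * u).

Definition nucleus (u : L) : Prop :=
  [/\ left_nucleus u, middle_nucleus u & right_nucleus u].

End Nuclei.

(* The permutations of a possibly infinite type; [{perm T}] needs a finite one.
   Two permutations are compared through their underlying functions, by [=1]. *)
Record SymGroup (T : Type) := MkSymGroup {
  sym_fun :> T -> T;
  sym_bwd : T -> T;
  sym_funK : cancel sym_fun sym_bwd;
  sym_bwdK : cancel sym_bwd sym_fun
}.

Definition sym_inv (T : Type) (p : SymGroup T) : SymGroup T :=
  MkSymGroup (@sym_bwdK T p) (@sym_funK T p).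

Definition is_automorphism (G : groupType) (p : G -> G) : Prop :=
  bijective p /\ monoid_morphism p.

(* [inner s t] is [t ^ s^-1], because [x ^ y] stands for [y^-1 * (x * y)]. *)
Definition inner (G : groupType) (s t : G) : G := s * t * s^-1.

(* An alias of [K * G], so that its product is not the componentwise one. The
   normalization proofs are arguments because the loop structure needs them. *)
Definition albert_ext (K : loopType) (G : groupType) (Gamma : K -> K -> SymGroup G)
    (Gamma1 : forall s : K, Gamma 1 s 1 = 1)
    (Gamma_id : forall s : K, Gamma s 1 =1 id) : Type :=
  (K * G)%type.

Section AlbertExtension.
Variables (K : loopType) (G : groupType) (Gamma : K -> K -> SymGroup G).
Hypothesis Gamma1 : forall s : K, Gamma 1 s 1 = 1.
Hypothesis Gamma_id : forall s : K, Gamma s 1 =1 id.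

Local Notation E := (albert_ext Gamma1 Gamma_id).

HB.instance Definition _ := Choice.copy E (K * G)%type.

Definition albert_mul (u v : E) : E :=
  (u.1 * v.1, Gamma u.1 v.1 u.2 * v.2).

HB.instance Definition _ := hasMul.Build E albert_mul.

Definition albert_one : E := (1, 1).

Fact albert_mul1g : left_id albert_one (@mul E).
Proof.
by case=> b y; rewrite /mul /= /albert_mul /= Gamma1 !mul1g.
Qed.

Fact albert_mulg1 : right_id albert_one (@mul E).
Proof.
by case=> a x; rewrite /mul /= /albert_mul /= Gamma_id !mulg1.
Qed.

HB.instance Definition _ := Magma_isUMagma.Build E albert_mul1g albert_mulg1.

Fact albert_ldiv (u w : E) : exists! x : E, u * x = w.
Proof.
case: u w => [a x] [c z]; have [b [<- ub]] := loop_ldiv a c.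
exists (b, (Gamma a b x)^-1 * z); split=> [|[b' y]].
  by congr pair; rewrite /= mulVKg.
by case=> /ub <- <-; rewrite mulKg.
Qed.

Fact albert_rdiv (v w : E) : exists! y : E, y * v = w.
Proof.
case: v w => [b y] [c z]; have [a [<- ua]] := loop_rdiv b c.
exists (a, sym_inv (Gamma a b) (z * y^-1)); split=> [|[a' x]].
  by congr pair; rewrite /= sym_bwdK mulgVK.
by case=> /ua <- <-; rewrite mulgK /= sym_funK.
Qed.

HB.instance Definition _ := UMagma_isLoop.Build E albert_ldiv albert_rdiv.

Definition albert_kernel (u : E) : Prop := u.1 = 1.

Definition left_nuclear : Prop :=
  forall u : E, albert_kernel u -> left_nucleus u.

Definition middle_nuclear : Prop :=
  forall u : E, albert_kernel u -> middle_nucleus u.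

Definition right_nuclear : Prop :=
  forall u : E, albert_kernel u -> right_nucleus u.

Definition nuclear : Prop :=
  forall u : E, albert_kernel u -> nucleus u.

Fact albert_right_nuclear : right_nuclear.
Proof.
case=> o c; rewrite /albert_kernel /= => -> [a x] [b y].
by congr pair; rewrite /= ?mulg1 // !Gamma_id mulgA.
Qed.

End AlbertExtension.

(* Main.v *)
(* Comparing second components, the kernel lies in the middle nucleus iff
     Gamma_{s,t}(a c) = Gamma_{s,t}(a) Theta_t(c),
   and in the left nucleus iff
     Gamma_{s,t}(Theta_s(c) a) = Theta_{st}(c) Gamma_{s,t}(a).
   Taking s = 1 makes each Theta_t a homomorphism (Theta_1 = Id), and taking
   a = 1 gives the two forms of Gamma. The two forms together say that
   f(s,t) Theta_t(g) = Theta_{st}(Theta_s^-1(g)) f(s,t), which is the condition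
   on inner automorphisms after substituting g = Theta_t^-1(u). *)
Require Import Defs.
From mathcomp Require Import all_boot.

Set Implicit Arguments.
Unset Strict Implicit.
Unset Printing Implicit Defensive.

Local Open Scope group_scope.

Section NuclearityCriteria.
Variables (K : loopType) (G : groupType) (Gamma : K -> K -> SymGroup G).
Hypothesis Gamma1 : forall s : K, Gamma 1 s 1 = 1.
Hypothesis Gamma_id : forall s : K, Gamma s 1 =1 id.

Lemma middle_nuclearP :
  middle_nuclear Gamma1 Gamma_id <->
  forall (s t : K) (a c : G), Gamma s t (a * c) = Gamma s t a * Gamma 1 t c.
Proof.
split=> [mid s t a c | eqG [o c]].
  (* The second component of the third factor may be 1: a general one only multiplies both sides on
     the right. *)
  have /(congr1 snd) /= := mid (1, c) erefl (s, a) (t, 1).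
  by rewrite !mulg1 Gamma_id mul1g.
rewrite /albert_kernel /= => -> [s a] [t b].
by congr pair; rewrite /= ?mulg1 ?mul1g // Gamma_id eqG mulgA.
Qed.

Lemma left_nuclearP :
  left_nuclear Gamma1 Gamma_id <->
  forall (s t : K) (a c : G),
    Gamma s t (Gamma 1 s c * a) = Gamma 1 (s * t) c * Gamma s t a.
Proof.
split=> [lef s t a c | eqG [o c]].
  have /(congr1 snd) /= := lef (1, c) erefl (s, a) (t, 1).
  by rewrite !mulg1 mul1g.
rewrite /albert_kernel /= => -> [s a] [t b].
by congr pair; rewrite /= ?mul1g // eqG mulgA.
Qed.

(** Right nuclearity is automatic by [albert_right_nuclear]. *)
Lemma nuclear_split :
  nuclear Gamma1 Gamma_id <->
  left_nuclear Gamma1 Gamma_id /\ middle_nuclear Gamma1 Gamma_id.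
Proof.
split=> [nuc | [lef mid] u ku].
  by split=> u /nuc[].
by split; [apply: lef | apply: mid | apply: albert_right_nuclear].
Qed.

End NuclearityCriteria.

Lemma sym_automorphism (G : groupType) (p : SymGroup G) :
  p 1 = 1 -> {morph p : x y / x * y} -> is_automorphism p.
Proof.
move=> p1 pM; split; last by split.
exact: Bijective (@sym_funK _ p) (@sym_bwdK _ p).
Qed.

Lemma sym_inv_morph (G : groupType) (p : SymGroup G) :
  is_automorphism p -> {morph sym_inv p : x y / x * y}.
Proof.
case=> _ [_ pM] x y; apply: (can_inj (@sym_funK _ p)).
by rewrite pM !sym_bwdK.
Qed.

(** The automorphism clause in (iii) does not follow from the other two: let [K] have order 2, [f]
    be constantly 1 and [Theta] at the generator be a non-multiplicative involution fixing 1. *)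
Theorem theorem21 (K : loopType) (G : groupType) (Gamma : K -> K -> SymGroup G)
    (Gamma1 : forall s : K, Gamma 1 s 1 = 1)
    (Gamma_id : forall s : K, Gamma s 1 =1 id) :
  let Theta (t : K) : SymGroup G := Gamma 1 t in
  let f (s t : K) : G := Gamma s t 1 in
  [/\ middle_nuclear Gamma1 Gamma_id <->
        (forall t : K, is_automorphism (Theta t)) /\
        (forall (s t : K) (g : G), Gamma s t g = f s t * Theta t g),
      left_nuclear Gamma1 Gamma_id <->
        (forall t : K, is_automorphism (Theta t)) /\
        (forall (s t : K) (g : G),
           Gamma s t g = Theta (s * t) (sym_inv (Theta s) g) * f s t)
    & nuclear Gamma1 Gamma_id <->
        [/\ forall t : K, is_automorphism (Theta t),
            forall (s t : K) (g : G), Gamma s t g = f s t * Theta t g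
          & forall s t : K,
              Theta (s * t) \o sym_inv (Theta s) \o sym_inv (Theta t)
              =1 inner (f s t)]].
Proof.
move=> Theta f.
have midE : middle_nuclear Gamma1 Gamma_id <->
    (forall t : K, is_automorphism (Theta t)) /\
    (forall (s t : K) (g : G), Gamma s t g = f s t * Theta t g).
  split=> [/middle_nuclearP eqG | [autT formG]].
    split=> [t | s t g]; last by rewrite -eqG mul1g.
    by apply: sym_automorphism => // x y; apply: eqG.
  apply/middle_nuclearP => s t a c.
  by have [_ [_ TM]] := autT t; rewrite (formG s t (a * c)) (formG s t a) TM mulgA.
have leftE : left_nuclear Gamma1 Gamma_id <->
    (forall t : K, is_automorphism (Theta t)) /\
    (forall (s t : K) (g : G),
       Gamma s t g = Theta (s * t) (sym_inv (Theta s) g) * f s t).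
  split=> [/left_nuclearP eqG | [autT formG]].
    split=> [t | s t g]; last by rewrite -eqG mulg1 sym_bwdK.
    apply: sym_automorphism => // x y.
    (* The arguments are swapped because the kernel element [c] is the left factor. *)
    by have := eqG 1 t y x; rewrite Gamma_id mul1g.
  apply/left_nuclearP => s t a c.
  have [_ [_ TM]] := autT (s * t).
  (* Multiplicativity of the inverse of [Theta s] pulls [c] out on the left. *)
  rewrite (formG s t (_ * a)) (formG s t a).
  by rewrite sym_inv_morph //= sym_funK TM mulgA.
split=> //; split=> [/nuclear_split[/leftE[autT formL] /midE[_ formM]] | ].
  split=> // s t u.
  have := formL s t (sym_inv (Theta t) u).
  by rewrite (formM s t) sym_bwdK /inner /= => ->; rewrite mulgK.
case=> autT formM innerT; apply/nuclear_split.
split; last exact/midE.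
apply/leftE; split=> // s t g.
(* Evaluating at [Theta t g] undoes the earlier substitution. *)
have := innerT s t (Theta t g).
by rewrite /inner /= sym_funK => ->; rewrite mulgVK (formM s t).
Qed.
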